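(* Let $\mathbf{C}\approx\tilde{\mathbf{C}}=\sum_{i=1}^r\bigotimes_{\mu=1}^d\mathbf{C}_{i\mu}$, where $\mathbf{C}_{i\mu}\in\mathbb{R}^{n\times n}$. The cost of computing the right-hand sides $$\sum_{i=1}^r\bigotimes_{\mu=1}^d\operatorname{diag}(\mathbf{C}_{i\mu})\qquad\text{and}\qquad \sum_{i=1}^r\prod_{\mu=1}^d\operatorname{trace}(\mathbf{C}_{i\mu})$$ of the formulas for $\operatorname{diag}(\tilde{\mathbf{C}})$ and $\operatorname{trace}(\tilde{\mathbf{C}})$, respectively, is $rdn$.
   Context: $\bigotimes$ denotes the Kronecker (tensor) product, $\operatorname{diag}$ the diagonal and $\operatorname{trace}$ the trace of a square matrix; $\mathbf{C}$ is an $N\times N$ matrix with $N=n^d$, and $r$ is the number of terms of its Kronecker approximation $\tilde{\mathbf{C}}$. The formulas whose right-hand sides are meant are $\operatorname{diag}(\tilde{\mathbf{C}})=\sum_{i=1}^r\bigotimes_{\mu=1}^d\operatorname{diag}(\mathbf{C}_{i\mu})$ and $\operatorname{trace}(\tilde{\mathbf{C}})=\sum_{i=1}^r\prod_{\mu=1}^d\operatorname{trace}(\mathbf{C}_{i\mu})$, which follow from the properties of Kronecker products. *)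

(* Defs.v *)
From HB Require Import structures.
From mathcomp Require Import all_boot all_order all_algebra.
From mathcomp Require Import reals mxtens.

Set Implicit Arguments.
Unset Strict Implicit.
Unset Printing Implicit Defensive.

Import Order.TTheory GRing.Theory Num.Theory.
Local Open Scope ring_scope.

Definition diagv (R : realType) (n : nat) (A : 'M[R]_n) : 'cV[R]_n :=
  \col_j A j j.

(* The Kronecker product v_0 (x) v_1 (x) ... (x) v_(d-1), a vector of length
   n ^ d; the casts only identify n * n ^ d with n ^ d.+1 and 1 * 1 with 1. *)
Fixpoint kronv (R : realType) (n d : nat) :
    ('I_d -> 'cV[R]_n) -> 'cV[R]_(n ^ d) :=
  match d return ('I_d -> 'cV[R]_n) -> 'cV[R]_(n ^ d) with
  | 0 => fun _ => const_mx 1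
  | d'.+1 => fun v =>
      castmx (esym (expnS n d'), muln1 1%N)
        (tensmx (v ord0) (kronv (fun mu => v (lift ord0 mu))))
  end.

(* Straight-line programs over the reals, the usual model of algebraic
   complexity.  I indexes the input cells and O the output cells.  An
   instruction applies one arithmetic operation to two operands and puts the
   result in a fresh register; after the last instruction one operand is written
   into each output cell. *)
Inductive operand (R I : Type) : Type :=
  | Const of R
  | Input of I
  | Reg of nat.

Inductive arith_op : Type := OpAdd | OpSub | OpMul | OpDiv.

Record instr (R I : Type) : Type := Instr {
  opcode : arith_op;
  arg1 : operand R I;
  arg2 : operand R I }.

Record program (R : Type) (I O : finType) : Type := Program {
  code : seq (instr R I);
  write : O -> operand R I }.

Definition apply_op (R : realType) (o : arith_op) (x y : R) : R :=
  match o with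
  | OpAdd => x + y
  | OpSub => x - y
  | OpMul => x * y
  | OpDiv => x / y
  end.

(* Registers not yet assigned hold 0. *)
Definition fetch (R : realType) (I : Type) (x : I -> R) (regs : seq R)
    (a : operand R I) : R :=
  match a with
  | Const c => c
  | Input i => x i
  | Reg k => nth 0 regs k
  end.

Definition exec_instr (R : realType) (I : Type) (x : I -> R) (regs : seq R)
    (s : instr R I) : seq R :=
  rcons regs
    (apply_op (opcode s) (fetch x regs (arg1 s)) (fetch x regs (arg2 s))).

Definition run (R : realType) (I O : finType) (P : program R I O)
    (x : I -> R) : O -> R :=
  fun o => fetch x (foldl (exec_instr x) [::] (code P)) (write P o).

(* Unit cost for each arithmetic operation and for each output cell written.
   Writes have to be charged: extracting a diagonal takes no arithmetic. *)
Definition cost (R : Type) (I O : finType) (P : program R I O) : nat :=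
  size (code P) + #|O|.

(* decode interprets the output cells as a value: it fixes the format in which
   the result is to be delivered. *)
Definition computes (R : realType) (I O : finType) (T : Type)
    (decode : (O -> R) -> T) (F : (I -> R) -> T) (P : program R I O) : Prop :=
  forall x : I -> R, decode (run P x) = F x.

Definition computing_cost (R : realType) (I O : finType) (T : Type)
    (decode : (O -> R) -> T) (F : (I -> R) -> T) (c : nat) : Prop :=
  (exists2 P : program R I O, computes decode F P & cost P = c) /\
  (forall P : program R I O, computes decode F P -> (c <= cost P)%N).

(* The input cell (i, mu, j, k) holds the entry (j, k) of C_{i mu}. *)
Definition entry_index (r d n : nat) : finType :=
  ('I_r * 'I_d * 'I_n * 'I_n)%type.

Definition factor (R : realType) (r d n : nat) (x : entry_index r d n -> R)
    (i : 'I_r) (mu : 'I_d) : 'M[R]_n :=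
  \matrix_(j, k) x (i, mu, j, k).

Definition diag_rhs (R : realType) (r d n : nat)
    (C : 'I_r -> 'I_d -> 'M[R]_n) : 'cV[R]_(n ^ d) :=
  \sum_(i < r) kronv (fun mu => diagv (C i mu)).

Definition trace_rhs (R : realType) (r d n : nat)
    (C : 'I_r -> 'I_d -> 'M[R]_n) : R :=
  \sum_(i < r) \prod_(mu < d) \tr (C i mu).

(* Vectors of length n ^ d are delivered in the r-term Kronecker format, i.e. by
   the coordinates j of the r * d factors v_{i mu}, the Kronecker products being
   left unexpanded (writing out all n ^ d coordinates would already cost at
   least n ^ d). *)
Definition kron_cells (r d n : nat) : finType := ('I_r * 'I_d * 'I_n)%type.

Definition kron_format (R : realType) (r d n : nat)
    (y : kron_cells r d n -> R) : 'cV[R]_(n ^ d) :=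
  \sum_(i < r) kronv (fun mu => \col_j y (i, mu, j)).

Definition scalar_format (R : realType) (y : unit -> R) : R := y tt.

(* Main.v *)
Require Import Defs.
From mathcomp Require Import all_boot all_order all_algebra.
From mathcomp Require Import reals zify.

(** Both costs are tight because of one counting principle: every instruction
    merges two values into one, so the number of inputs that can influence the
    outputs is at most the number of instructions plus the number of output
    cells, which is exactly the cost ([run_dependency]).  Conversely a formula
    with [l] leaves needs [l - 1] operations and one write, hence cost [l]
    ([evaluable_op]).

    For the trace, the formula [\sum_i \prod_mu \sum_j x (i, mu, j, j)] has
    [r * d * n] leaves, one for each diagonal entry, which gives the upper
    bound.  It also depends on each of these entries: if the only nonzero
    entries are ones at position [(j, j)] of the factors of term [i], the value
    is one, and it drops to zero when any of these ones is erased
    ([trace_rhs_unit_entries]).  So the counting principle gives the same number as a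
    lower bound.

    For the diagonal in Kronecker format no arithmetic is needed: the
    [r * d * n] coordinates of the factors are copied, and the number of output
    cells is already a lower bound for the cost. *)

Import GRing.Theory.
Local Open Scope ring_scope.

(** * Register contents of a straight-line program *)

Definition registers {R : realType} {I : Type} (x : I -> R)
    (c : seq (instr R I)) : seq R := foldl (exec_instr x) [::] c.

Lemma registers_rcons {R : realType} {I : Type} (x : I -> R) c s :
  registers x (rcons c s) = exec_instr x (registers x c) s.
Proof. by rewrite /registers -cats1 foldl_cat. Qed.

Lemma size_registers {R : realType} {I : Type} (x : I -> R) c :
  size (registers x c) = size c.
Proof.
by elim/last_ind: c => // c s IHc; rewrite registers_rcons !size_rcons IHc.
Qed.

Lemma nth_registers_rcons {R : realType} {I : Type} (x : I -> R) c s k :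
  k != size c ->
  nth 0 (registers x (rcons c s)) k = nth 0 (registers x c) k.
Proof.
move=> ne_k; rewrite registers_rcons nth_rcons size_registers (negPf ne_k).
by case: ltnP => // le_k; rewrite nth_default ?size_registers.
Qed.

Lemma nth_registers_last {R : realType} {I : Type} (x : I -> R) c s :
  nth 0 (registers x (rcons c s)) (size c) =
  apply_op (opcode s) (fetch x (registers x c) (arg1 s))
                      (fetch x (registers x c) (arg2 s)).
Proof.
by rewrite registers_rcons nth_rcons size_registers ltnn eqxx.
Qed.

Lemma nth_registers_cat {R : realType} {I : Type} (x : I -> R) c c' k :
  (k < size c)%N ->
  nth 0 (registers x (c ++ c')) k = nth 0 (registers x c) k.
Proof.
move=> lt_k; elim/last_ind: c' => [|c' s IHc]; first by rewrite cats0.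
rewrite -rcons_cat nth_registers_rcons ?IHc //.
by rewrite size_cat neq_ltn ltn_addr.
Qed.

(** * Lower bound: the outputs depend on at most [cost P] inputs *)

Definition operand_inputs {R I : Type} (a : operand R I) : seq I :=
  if a is Input i then [:: i] else [::].

Definition operand_regs {R I : Type} (a : operand R I) : seq nat :=
  if a is Reg k then [:: k] else [::].

Lemma size_operand {R I : Type} (a : operand R I) :
  (size (operand_inputs a) + size (operand_regs a) <= 1)%N.
Proof. by case: a. Qed.

Lemma fetch_dependency {R : realType} {I : eqType} (x y : I -> R) rx ry a :
    {in operand_inputs a, x =1 y} ->
    {in operand_regs a, nth 0 rx =1 nth 0 ry} ->
  fetch x rx a = fetch y ry a.
Proof.
case: a => [//|i|k] /= eqI eqr; first by rewrite eqI ?mem_seq1.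
by rewrite eqr ?mem_seq1.
Qed.

(** Going backwards through the code, the last instruction, if its register is
    observed at all, trades that register for its at most two operands; each
    instruction thus adds at most one to the number of values observed. *)
Lemma registers_dependency {R : realType} {I : eqType} (c : seq (instr R I))
    (ks : seq nat) :
  exists2 D : seq I, (size D <= size c + size ks)%N &
    forall x y : I -> R, {in D, x =1 y} ->
      {in ks, nth 0 (registers x c) =1 nth 0 (registers y c)}.
Proof.
elim/last_ind: c ks => [|c s IHc] ks; first by exists [::].
pose ks' := [seq k <- ks | k != size c].
have [last_ks|last_ks] := boolP (size c \in ks); last first.
  have [D leD depD] := IHc ks; exists D.
    by rewrite size_rcons (leq_trans leD) ?leq_add2r.
  move=> x y eqD k k_ks.
  have ne_k : k != size c by apply: contraNneq last_ks => <-.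
  by rewrite !nth_registers_rcons ?(depD x y eqD).
have lt_ks' : (size ks' < size ks)%N.
  rewrite size_filter -(count_predC (pred1 (size c)) ks) -[ltnLHS]add0n.
  by rewrite ltn_add2r -has_count has_pred1.
have [D leD depD] := IHc (operand_regs (arg1 s) ++ operand_regs (arg2 s) ++ ks').
exists (operand_inputs (arg1 s) ++ operand_inputs (arg2 s) ++ D).
  have := size_operand (arg1 s); have := size_operand (arg2 s).
  move: leD; rewrite !size_cat size_rcons.
  move: lt_ks'; move: (size D) (size c) (size ks) (size ks').
  by lia.
move=> x y eqD.
have [eqI1 eqI2 eqID] : [/\ {in operand_inputs (arg1 s), x =1 y},
    {in operand_inputs (arg2 s), x =1 y} & {in D, x =1 y}].
  by split=> i iP; apply: eqD; rewrite !mem_cat iP ?orbT.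
have eqR := depD x y eqID.
move=> k k_ks; have [->|ne_k] := eqVneq k (size c); last first.
  rewrite !nth_registers_rcons //; apply: eqR.
  by rewrite !mem_cat mem_filter ne_k k_ks !orbT.
rewrite !nth_registers_last; congr apply_op; apply: fetch_dependency => // m mP.
  by apply: eqR; rewrite mem_cat mP.
by apply: eqR; rewrite !mem_cat mP orbT.
Qed.

Lemma run_dependency {R : realType} {I O : finType} (P : program R I O) :
  exists2 D : {set I}, (#|D| <= cost P)%N &
    forall x y : I -> R, {in D, x =1 y} -> run P x =1 run P y.
Proof.
pose ins := flatten [seq operand_inputs (write P o) | o <- enum O].
pose ks := flatten [seq operand_regs (write P o) | o <- enum O].
have le_ops : (size ins + size ks <= #|O|)%N.
  rewrite cardE /ins /ks; elim: (enum O) => //= o os IHos.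
  by have := size_operand (write P o); rewrite !size_cat; lia.
have [D leD depD] := registers_dependency (code P) ks.
exists [set i in ins ++ D].
  rewrite cardsE (leq_trans (card_size _)) // size_cat.
  rewrite (leq_trans (leq_add (leqnn _) leD)) // addnCA /cost.
  by rewrite leq_add2l.
move=> x y eqD o; apply: fetch_dependency => [i iP|].
  apply: eqD; rewrite inE mem_cat; apply/orP; left.
  by apply/flatten_mapP; exists o; rewrite ?mem_enum.
move=> k kP; apply: depD => [i iD|]; first by rewrite eqD // inE mem_cat iD orbT.
by apply/flatten_mapP; exists o; rewrite ?mem_enum.
Qed.

(** * Upper bound: a formula with [l] leaves costs [l] *)

(** The code [c] before and [c'] after are arbitrary, so that programs can be
    concatenated: the value must stay available while later parts are run.  The
    index [l] counts one more than the number of instructions, for the write,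
    which makes it additive under arithmetic operations. *)
Definition evaluable {R : realType} {I : Type} (f : (I -> R) -> R)
    (l : nat) : Prop :=
  forall c : seq (instr R I), exists (p : seq (instr R I)) (a : operand R I),
    (size p).+1 = l /\
    forall c' x, fetch x (registers x (c ++ p ++ c')) a = f x.

Lemma evaluable_ext {R : realType} {I : Type} {f g : (I -> R) -> R} {l} :
  evaluable f l -> f =1 g -> evaluable g l.
Proof.
move=> ev_f fg c; have [p [a [sz_p fetch_a]]] := ev_f c.
by exists p, a; split=> // c' x; rewrite fetch_a fg.
Qed.

Lemma evaluable_input {R : realType} {I : Type} (i : I) :
  evaluable (fun x : I -> R => x i) 1.
Proof. by move=> c; exists [::], (Input R i). Qed.

Lemma evaluable_op {R : realType} {I : Type} o {f g : (I -> R) -> R} {l m} :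
  evaluable f l -> evaluable g m ->
  evaluable (fun x => apply_op o (f x) (g x)) (l + m).
Proof.
move=> ev_f ev_g c; have [p [a [<- fetch_a]]] := ev_f c.
have [q [b [<- fetch_b]]] := ev_g (c ++ p).
pose s := Instr o a b; exists (p ++ rcons q s), (Reg R I (size (c ++ p ++ q))).
split=> [|c' x]; first by rewrite size_cat size_rcons addSn addnS.
rewrite !catA -!rcons_cat -!catA /= nth_registers_cat ?size_rcons //.
rewrite nth_registers_last /= fetch_a.
by have := fetch_b [::] x; rewrite cats0 -catA => ->.
Qed.

Lemma evaluable_big {R : realType} {I : Type} o idx (op : Monoid.law idx)
    (opE : apply_op o =2 op :> (R -> R -> R)) n (f : 'I_n -> (I -> R) -> R) l :
  (0 < n)%N -> (forall i, evaluable (f i) l) ->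
  evaluable (fun x => \big[op/idx]_(i < n) f i x) (n * l).
Proof.
case: n f => // n; elim: n => [|n IHn] f _ ev_f.
  rewrite mul1n; apply: (evaluable_ext (ev_f ord0)) => x.
  by rewrite big_ord_recl big_ord0 Monoid.mulm1.
rewrite mulSnr; have ev_n := IHn (fun i => f (widen_ord (leqnSn _) i)) isT
  (fun i => ev_f _).
apply: (evaluable_ext (evaluable_op o ev_n (ev_f ord_max))) => x.
by rewrite opE [RHS]big_ord_recr.
Qed.

Lemma evaluable_program {R : realType} {I : finType} (f : (I -> R) -> R) l :
  evaluable f l ->
  exists2 P : program R I unit, computes (@scalar_format R) f P & cost P = l.
Proof.
move=> /(_ [::]) [p [a [<- fetch_a]]]; exists (Program p (fun=> a)).
  by move=> x; rewrite -(fetch_a [::]) cats0.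
by rewrite /cost card_unit addn1.
Qed.

(** * The trace formula *)

Lemma evaluable_trace_rhs {R : realType} r d n :
  (0 < r)%N -> (0 < d)%N -> (0 < n)%N ->
  evaluable (fun x : entry_index r d n -> R => trace_rhs (factor x))
    (r * d * n).
Proof.
move=> r_gt0 d_gt0 n_gt0; rewrite -mulnA.
apply: (@evaluable_big _ _ OpAdd) => // i.
apply: (@evaluable_big _ _ OpMul) => // mu.
rewrite -[n in evaluable _ n]muln1.
apply: (@evaluable_big _ _ OpAdd) => // j.
by apply: (evaluable_ext (evaluable_input (i, mu, j, j))) => x; rewrite mxE.
Qed.

(** The test inputs: in term [i], the factors selected by [p] are the matrix
    unit at [(j, j)], and all other entries vanish. *)
Definition unit_entries (R : realType) {r d n} (i : 'I_r) (p : pred 'I_d)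
    (j : 'I_n) : entry_index r d n -> R :=
  fun e => let: (i', mu, k, l) := e in
    [&& i' == i, p mu, k == j & l == j]%:R.

(** Some factor exists, so the terms other than [i] contain a zero factor and
    drop out; in term [i], a single missing factor annihilates the product. *)
Lemma trace_rhs_unit_entries (R : realType) r d n (i : 'I_r) (p : pred 'I_d)
    (j : 'I_n) :
  (0 < d)%N ->
  trace_rhs (factor (unit_entries R i p j)) = [forall mu, p mu]%:R.
Proof.
move=> d_gt0.
have trE i' mu :
    \tr (factor (unit_entries R i p j) i' mu) = ((i' == i) && p mu)%:R.
  rewrite /mxtrace (bigD1 j) //= big1 => [|k ne_k]; last first.
    by rewrite mxE /= (negPf ne_k) !andbF.
  by rewrite mxE /= eqxx !andbT addr0.
rewrite /trace_rhs (bigD1 i) //= [X in _ + X]big1 => [|i' ne_i].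
  rewrite addr0; under eq_bigr do rewrite trE eqxx /=.
  have [/forallP p_all|] := boolP [forall mu, p mu].
    by rewrite big1 // => mu _; rewrite p_all.
  by rewrite negb_forall => /existsP[mu /negPf Np]; rewrite (bigD1 mu) //= Np mul0r.
by rewrite (bigD1 (Ordinal d_gt0)) //= trE (negPf ne_i) mul0r.
Qed.

(** A program that does not depend on the entry [(i, mu, j, j)] cannot tell two
    test inputs apart that have different traces. *)
Lemma trace_rhs_cost_ge {R : realType} r d n
    (P : program R (entry_index r d n) unit) :
  (0 < d)%N ->
  computes (@scalar_format R) (fun x => trace_rhs (factor x)) P ->
  (r * d * n <= cost P)%N.
Proof.
move=> d_gt0 compP; have [D leD depD] := run_dependency P.
apply: leq_trans leD.
pose diag_entry (t : 'I_r * 'I_d * 'I_n) : entry_index r d n := (t, t.2).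
have inj_diag : injective diag_entry by move=> t u [].
suff subD : diag_entry @: setT \subset D.
  have := subset_leq_card subD.
  by rewrite card_imset // cardsT !card_prod !card_ord.
apply/subsetP => _ /imsetP[[[i mu] j] _ ->]; apply: contraT => notD.
pose x := unit_entries R i (@predT 'I_d) j; pose y := unit_entries R i (predC1 mu) j.
have eqD : {in D, x =1 y}.
  move=> [[[i' mu'] k] l] /= inD; rewrite /x /y /=.
  congr (nat_of_bool _)%:R; apply/and3P/and4P=> -[/eqP ei].
    move=> /eqP ek /eqP el; split; rewrite ?ei ?ek ?el //=.
    apply: contraNneq notD => emu.
    by rewrite /diag_entry /= -ei -emu -{1}ek -el.
  by split=> //; apply/eqP.
have : trace_rhs (factor x) = trace_rhs (factor y).
  by rewrite -[LHS](compP x) -[RHS](compP y); apply: depD.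
rewrite !trace_rhs_unit_entries //.
have -> : [forall nu : 'I_d, predT nu] by apply/forallP.
have -> : [forall nu, predC1 mu nu] = false.
  by apply/forallP => /(_ mu) /=; rewrite eqxx.
by move/eqP; rewrite oner_eq0.
Qed.

(** * The two costs *)

Theorem lemma4p2 (R : realType) (r d n : nat)
    (r_gt0 : (0 < r)%N) (d_gt0 : (0 < d)%N) (n_gt0 : (0 < n)%N) :
  computing_cost (@kron_format R r d n)
    (fun x : entry_index r d n -> R => diag_rhs (factor x)) (r * d * n)%N /\
  computing_cost (@scalar_format R)
    (fun x : entry_index r d n -> R => trace_rhs (factor x)) (r * d * n)%N.
Proof.
have card_cells : #|kron_cells r d n| = (r * d * n)%N.
  by rewrite !card_prod !card_ord.
split; split.
- exists (Program [::] (fun t : kron_cells r d n =>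
    Input R ((t, t.2) : entry_index r d n))); last by rewrite /cost card_cells.
  move=> x; apply: eq_bigr => i _; congr kronv.
  by apply: boolp.funext => mu; apply/colP => j; rewrite !mxE.
- by move=> P _; rewrite -card_cells leq_addl.
- exact/evaluable_program/evaluable_trace_rhs.
- by move=> P; apply: trace_rhs_cost_ge.
Qed.
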